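(* Let $A$ be a finite alphabet and let $F_A$ be the free group with basis $A$. Let $K$ and $L$ be rational subsets of $F_A$. Then $\alpha(K,L)=\bigcup_{u\in L}u^{-1}Ku$ is a context-free subset of $F_A$.
   Context: For a group $G$ generated by a finite set $A$, let $\widetilde A=A\cup A^{-1}$ and let $\pi:\widetilde A^*\to G$ be the canonical surjective monoid homomorphism. A subset $K\subseteq G$ is rational if $K=L\pi$ (the image of $L$) for some rational (regular) language $L\subseteq\widetilde A^*$; it is context-free if the full preimage $K\pi^{-1}\subseteq\widetilde A^*$ is a context-free language. (These notions do not depend on the choice of finite generating set.) For $K,L\subseteq F_A$, $\alpha(K,L)=\bigcup_{u\in L}u^{-1}Ku$, the product and inverse being taken in $F_A$. *)

(* Defs.v *)
From HB Require Import structures.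
From mathcomp Require Import all_boot.
From mathcomp Require Import classical_sets.
From Stdlib Require Import Relation_Operators.

Set Implicit Arguments.
Unset Strict Implicit.
Unset Printing Implicit Defensive.

Local Open Scope classical_set_scope.
Local Open Scope group_scope.

Section Languages.
Variable X : finType.

(* Nondeterministic, without epsilon-transitions. *)
Record automaton := Automaton {
  state : finType;
  initial : {set state};
  terminal : {set state};
  edge : state -> X -> state -> bool }.

Fixpoint accepts_from (M : automaton) (p : state M) (w : seq X) : bool :=
  if w is x :: w' then [exists q, edge p x q && accepts_from q w']
  else p \in terminal M.

Definition recognized (M : automaton) : set (seq X) :=
  [set w | [exists p, (p \in initial M) && accepts_from p w]].

Definition rational_language (L : set (seq X)) : Prop :=
  exists M : automaton, L = recognized M.

(* In sentential forms, [inl] marks nonterminals and [inr] terminals. *)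
Record grammar := Grammar {
  nonterminal : finType;
  start : nonterminal;
  productions : seq (nonterminal * seq (nonterminal + X)) }.

Definition derives_step (S : grammar) (u v : seq (nonterminal S + X)) : Prop :=
  exists l r n s, [/\ (n, s) \in productions S,
    u = l ++ inl n :: r & v = l ++ s ++ r].

Definition generated (S : grammar) : set (seq X) :=
  [set w | clos_refl_trans _ (@derives_step S)
             [:: inl (start S)] [seq inr x | x <- w]].

Definition context_free_language (L : set (seq X)) : Prop :=
  exists S : grammar, L = generated S.

End Languages.

(* The alphabet A u A^-1, as a disjoint union: (a, false) stands for a and
   (a, true) for a^-1. *)
Definition letter (A : finType) : finType := (A * bool)%type.

Definition invl (A : finType) (x : letter A) : letter A := (x.1, ~~ x.2).

Section Subsets.
Variables (A : finType) (G : groupType) (g : A -> G).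

Definition letter_eval (x : letter A) : G := if x.2 then (g x.1)^-1 else g x.1.

Definition word_eval (w : seq (letter A)) : G := \prod_(x <- w) letter_eval x.

(* These two notions are meant for families g that generate G. *)
Definition rational_subset (K : set G) : Prop :=
  exists2 L : set (seq (letter A)),
    rational_language L & K = word_eval @` L.

Definition context_free_subset (K : set G) : Prop :=
  context_free_language (word_eval @^-1` K).

End Subsets.

Definition alpha (G : groupType) (K L : set G) : set G :=
  \bigcup_(u in L) [set u^-1 * k * u | k in K].

Section FreeGroup.
Variable A : finType.
Implicit Types (x y : letter A) (u v w : seq (letter A)).

Definition reduced w := sorted (fun x y => y != invl x) w.

Definition cons_red x w :=
  if w is y :: w' then if y == invl x then w' else x :: w else [:: x].

Definition reduce w := foldr cons_red [::] w.

Lemma invlK : involutive (@invl A).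
Proof. by case=> a b; rewrite /invl /= negbK. Qed.

Lemma cons_red_reduced x w : reduced w -> reduced (cons_red x w).
Proof.
case: w => [|y w] //= yw; case: ifP => [_|/negbT yx].
  by rewrite /reduced (path_sorted yw).
by rewrite /reduced /= yx.
Qed.

Lemma reduce_reduced w : reduced (reduce w).
Proof. by elim: w => //= x w IHw; apply: cons_red_reduced. Qed.

Lemma reduce_id w : reduced w -> reduce w = w.
Proof.
elim: w => //= x w IHw xw; rewrite IHw; last exact: path_sorted xw.
by case: w xw {IHw} => //= y w /andP[/negbTE-> _].
Qed.

Lemma cons_redK x w : reduced w -> cons_red (invl x) (cons_red x w) = w.
Proof.
case: w => [|y w] /=; first by rewrite invlK eqxx.
case: eqP => [-> |_ _] /=; last by rewrite invlK eqxx.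
by case: w => //= z w /andP[/negbTE-> _].
Qed.

Lemma reduce_cat u v : reduce (u ++ v) = foldr cons_red (reduce v) u.
Proof. by rewrite /reduce foldr_cat. Qed.

Lemma reduce_catr u v : reduce (u ++ reduce v) = reduce (u ++ v).
Proof. by rewrite !reduce_cat (reduce_id (reduce_reduced v)). Qed.

Lemma reduce_catl u v : reduce (reduce u ++ v) = reduce (u ++ v).
Proof.
have foldr_reduced w : reduced (foldr cons_red (reduce v) w).
  by rewrite -reduce_cat reduce_reduced.
rewrite !reduce_cat; elim: u => //= x u <-.
case: (reduce u) => //= y w; case: eqP => //= ->.
by rewrite -{1}(cons_redK (invl x) (foldr_reduced w)) invlK.
Qed.

Lemma reduced_cat_inv w : reduce (rev (map (@invl A) w) ++ w) = [::].
Proof.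
elim: w => //= x w IHw; rewrite rev_cons cat_rcons reduce_cat /=.
by rewrite cons_redK ?reduce_reduced // -reduce_cat.
Qed.

Lemma reduced_inv w : reduced w -> reduced (rev (map (@invl A) w)).
Proof.
rewrite /reduced rev_sorted sorted_map; apply: sub_sorted => x y /=.
by apply: contraNneq => ->; rewrite invlK.
Qed.

Record free_group := FreeGroup {
  fg_word : seq (letter A); fg_wordP : reduced fg_word }.

HB.instance Definition _ := [isSub for fg_word].
HB.instance Definition _ := [Choice of free_group by <:].

Definition fg_of w := FreeGroup (reduce_reduced w).
Definition fg_one : free_group := fg_of [::].
Definition fg_mul (u v : free_group) : free_group :=
  fg_of (fg_word u ++ fg_word v).
Definition fg_inv (u : free_group) : free_group :=
  FreeGroup (reduced_inv (fg_wordP u)).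

Lemma fg_mulA : associative fg_mul.
Proof.
by move=> u v w; apply: val_inj; rewrite /= reduce_catr reduce_catl catA.
Qed.

Lemma fg_mul1g : left_id fg_one fg_mul.
Proof. by move=> u; apply: val_inj; rewrite /= reduce_id ?fg_wordP. Qed.

Lemma fg_mulg1 : right_id fg_one fg_mul.
Proof. by move=> u; apply: val_inj; rewrite /= cats0 reduce_id ?fg_wordP. Qed.

Lemma fg_mulVg : left_inverse fg_one fg_inv fg_mul.
Proof. by move=> u; apply: val_inj; rewrite /= reduced_cat_inv. Qed.

Lemma fg_mulgV : right_inverse fg_one fg_inv fg_mul.
Proof.
move=> u; apply: val_inj => /=; rewrite -{1}[fg_word u](mapK invlK).
by rewrite -{1}[map _ (fg_word u)]revK map_rev reduced_cat_inv.
Qed.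

HB.instance Definition _ :=
  isGroup.Build free_group fg_mulA fg_mul1g fg_mulg1 fg_mulVg fg_mulgV.

Definition fg_gen (a : A) : free_group := fg_of [:: (a, false)].

Lemma word_eval_fg_gen w : word_eval fg_gen w = fg_of w.
Proof.
rewrite /word_eval; elim: w => [|x w IHw]; first by rewrite big_nil.
rewrite big_cons IHw; apply: val_inj => /=.
by rewrite reduce_catr /letter_eval; case: x => a [].
Qed.

Lemma word_eval_fg_word (u : free_group) : word_eval fg_gen (fg_word u) = u.
Proof.
by rewrite word_eval_fg_gen; apply: val_inj; rewrite /= reduce_id ?fg_wordP.
Qed.

End FreeGroup.

Lemma free_group_universal (A : finType) (G : groupType) (g : A -> G) :
  exists2 f : free_group A -> G,
    {morph f : x y / x * y} /\ (forall a, f (fg_gen a) = g a) &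
    forall f' : free_group A -> G,
      {morph f' : x y / x * y} -> (forall a, f' (fg_gen a) = g a) -> f' =1 f.
Proof.
have evalV x : letter_eval g x * letter_eval g (invl x) = 1.
  by case: x => a []; rewrite /letter_eval /= (mulVg, mulgV).
have eval_cat u v : word_eval g (u ++ v) = word_eval g u * word_eval g v.
  by rewrite /word_eval big_cat.
have eval_reduce w : word_eval g (reduce w) = word_eval g w.
  elim: w => //= x w IHw; rewrite /word_eval big_cons -/(word_eval g w) -IHw.
  case: (reduce w) => [|y w'] /=; first by rewrite big_seq1 /word_eval big_nil mulg1.
  case: eqP => [->|_]; last by rewrite big_cons.
  by rewrite /word_eval big_cons mulgA evalV mul1g.
exists (fun u => word_eval g (fg_word u)).
  split=> [u v|a]; first by rewrite -eval_cat /= eval_reduce.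
  by rewrite /word_eval big_seq1.
move=> f' f'M f'g u; have f'1: f' 1 = 1.
  by apply: (mulgI (f' 1)); rewrite -f'M !mulg1.
have f'V x : f' x^-1 = (f' x)^-1.
  by apply: (mulgI (f' x)); rewrite -f'M !mulgV.
rewrite -{1}(word_eval_fg_word u) /word_eval; elim: (fg_word u) => [|x w IHw].
  by rewrite !big_nil.
rewrite !big_cons f'M IHw; congr (_ * _).
by case: x => a []; rewrite /letter_eval /= ?f'V f'g.
Qed.

(* Main.v *)
(** By Benois, [K] and [L] may be given by automata that accept the reduced form
    of each of their elements.  Take reduced words [k] in [K] and [h] in [L],
    with [k] nontrivial, and write [k = c y c^-1] with [y] cyclically reduced.
    Cancelling in [h^-1 k h] amounts to stripping from [h] a prefix of [c], or
    all of [c] followed by a prefix of a power of [y] or of [y^-1]; so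
    [h^-1 k h] has a reduced form [u^-1 y2 y1 u] where
    [k = c y1 y2 c^-1] and [h] is [c (y1 y2)^n y1 u] or
    [c (y1 y2)^-n y2^-1 u].  For fixed [c] and [n], whether such words are
    accepted depends only on the transition relations of [u], [y1], [y2] and
    their inverses, which a grammar that generates [u^-1 y2 y1 u] from both ends
    can track.  Inserting words representing the identity between the letters
    then gives the full preimage. *)

Require Import Defs.
From mathcomp Require Import all_boot.
From mathcomp Require Import boolp classical_sets.
From Stdlib Require Import Relation_Operators.

Set Implicit Arguments.
Unset Strict Implicit.
Unset Printing Implicit Defensive.

Local Open Scope classical_set_scope.
Local Open Scope group_scope.

(** * Derivations in context-free grammars *)

Section Derivations.
Variables (X : finType) (S : grammar X).
Implicit Types (u v : seq (nonterminal S + X)).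

Definition derives u v := clos_refl_trans _ (@derives_step X S) u v.

Lemma derives_ctx l r u v : derives u v -> derives (l ++ u ++ r) (l ++ v ++ r).
Proof.
elim=> [_ _ [l' [r' [n [s [ns -> ->]]]]]|?|? ? ? _ IH1 _ IH2].
- apply: rt_step; exists (l ++ l'), (r' ++ r), n, s; split=> //.
    by rewrite -!catA.
  by rewrite -!catA.
- exact: rt_refl.
- exact: rt_trans IH1 IH2.
Qed.

Lemma derives_cat u u' v v' :
  derives u v -> derives u' v' -> derives (u ++ u') (v ++ v').
Proof.
move=> uv u'v'; apply: (@rt_trans _ _ _ (v ++ u')).
  exact: (@derives_ctx [::] u').
by have := @derives_ctx v [::] _ _ u'v'; rewrite !cats0.
Qed.

End Derivations.

(** * The grammar of all sound productions of bounded length *)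

Section SoundGrammar.
Variables (X N : finType) (I : N -> set (seq X)) (n0 : N) (k : nat).
Implicit Types (s : seq (N + X)) (w : seq X).

Definition interp_symbol (a : N + X) : set (seq X) :=
  match a with inl n => I n | inr x => [set [:: x]] end.

Fixpoint interp s : set (seq X) :=
  if s is a :: s' then
    [set w | exists u v, [/\ w = u ++ v, interp_symbol a u & interp s' v]]
  else [set [::]].

Lemma interp_cat s1 s2 w :
  interp (s1 ++ s2) w <->
  exists u v, [/\ w = u ++ v, interp s1 u & interp s2 v].
Proof.
elim: s1 w => [|a s1 IH] w /=.
  split=> [sw|[_ [v [-> -> //]]]]; by exists [::], w.
split.
  move=> [u [v [-> au /IH[v1 [v2 [-> s1v s2v]]]]]].
  by exists (u ++ v1), v2; split; rewrite ?catA //; exists u, v1.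
move=> [_ [v2 [-> [u [v1 [-> au s1v]]] s2v]]].
exists u, (v1 ++ v2); rewrite catA; split=> //.
by apply/IH; exists v1, v2.
Qed.

Lemma interp_terminal w : interp [seq inr x | x <- w] w.
Proof. by elim: w => //= x w IH; exists [:: x], w. Qed.

(* Every production of bounded length that is sound for [I] is included, so
   only completeness has to be checked in each application. *)
Definition sound_grammar : grammar X := @Grammar X N n0
  [seq (p.1, bseqval p.2)
     | p <- [seq p : N * k.-bseq (N + X) <- enum {: N * k.-bseq (N + X)}
               | `[< interp p.2 `<=` I p.1 >]]].

(** Applying a sound production inside a sentential form can only shrink its interpretation, and a
    terminal word belongs to its own interpretation. *)
Lemma sound_grammar_sound : generated sound_grammar `<=` I n0.
Proof.
move=> w w_gen.
have : interp [:: inl n0 : N + X] `<=` I n0.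
  by move=> _ [u [v [-> nu ->]]]; rewrite cats0.
apply; have := interp_terminal w; move: w_gen.
rewrite /generated /=; set u := [:: _]; set v := map _ _.
have step (u' v' : seq (N + X)) : clos_refl_trans _
    (@derives_step X sound_grammar) u' v' -> interp v' `<=` interp u'.
  elim=> {u' v'} [x y [l [r [n [s [/mapP[[m t] /=]]]]]]|x z //|].
    rewrite mem_filter => /andP[/asboolP/= tI _] [-> ->] -> -> z.
    move=> /interp_cat[z1 [_ [-> lz1 /interp_cat[z2 [z3 [-> tz2 rz3]]]]]].
    apply/interp_cat; exists z1, (z2 ++ z3); split=> //.
    by exists z2, z3; split=> //; apply: tI.
  by move=> ? ? ? _ IH1 _ IH2 z /IH2/IH1.
by move=> /step sub /sub.
Qed.

Lemma derives_sound n s : size s <= k -> interp s `<=` I n ->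
  @derives X sound_grammar [:: inl n] s.
Proof.
move=> sk sI; apply: rt_step; exists [::], [::], n, s.
split; rewrite ?cats0 //.
apply/mapP; exists (n, Bseq sk) => //.
by rewrite mem_filter mem_enum andbT; apply/asboolP.
Qed.

End SoundGrammar.

(** * Formal inverses, and words padded with identities *)

Section Words.
Variable A : finType.
Implicit Types (x y z : letter A) (u v w k : seq (letter A)).

Definition invw w := rev (map (@invl A) w).

Lemma invwK : involutive invw.
Proof. by move=> w; rewrite /invw map_rev revK (mapK (@invlK A)). Qed.

Lemma invw_cat u v : invw (u ++ v) = invw v ++ invw u.
Proof. by rewrite /invw map_cat rev_cat. Qed.

Lemma invw_cons x u : invw (x :: u) = rcons (invw u) (invl x).
Proof. by rewrite /invw /= rev_cons. Qed.

Lemma invl_neq x : invl x != x.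
Proof. by case: x => a []; apply/eqP; case. Qed.

Lemma eq_invl x y : (x == invl y) = (y == invl x).
Proof. by apply/eqP/eqP => ->; rewrite invlK. Qed.

Section Eval.
Variables (G : groupType) (g : A -> G).
Local Notation ev := (word_eval g).

Lemma word_eval_nil : ev [::] = 1.
Proof. by rewrite /word_eval big_nil. Qed.

Lemma word_eval_cat u v : ev (u ++ v) = ev u * ev v.
Proof. by rewrite /word_eval big_cat. Qed.

Lemma word_eval_cons x v : ev (x :: v) = letter_eval g x * ev v.
Proof. by rewrite /word_eval big_cons. Qed.

Lemma letter_eval_inv x : letter_eval g (invl x) = (letter_eval g x)^-1.
Proof. by case: x => a []; rewrite /letter_eval /= ?invgK. Qed.

Lemma word_eval_inv u : ev (invw u) = (ev u)^-1.
Proof.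
elim: u => [|x u IH]; first by rewrite /invw /= word_eval_nil invg1.
rewrite invw_cons -cats1 word_eval_cat IH !word_eval_cons word_eval_nil mulg1.
by rewrite letter_eval_inv invgM.
Qed.

End Eval.

Local Notation ev := (word_eval (@fg_gen A)).

Lemma ev_eq_reduce u v : ev u = ev v -> reduce u = reduce v.
Proof. by rewrite !word_eval_fg_gen => /(congr1 (@fg_word A)). Qed.

(* [padded c w]: [w] arises from [c] by inserting words that represent the
   identity before, between and after the letters of [c]. *)
Inductive padded : seq (letter A) -> seq (letter A) -> Prop :=
| padded_nil e : ev e = 1 -> padded [::] e
| padded_cons e x c w : ev e = 1 -> padded c w ->
    padded (x :: c) (e ++ x :: w).

Lemma padded_catl e c w : ev e = 1 -> padded c w -> padded c (e ++ w).
Proof.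
move=> e1 [e' e'1|e' x c' w' e'1 cw].
  by apply: padded_nil; rewrite word_eval_cat e1 e'1 mulg1.
rewrite catA; apply: padded_cons cw.
by rewrite word_eval_cat e1 e'1 mulg1.
Qed.

Lemma padded_nilE w : padded [::] w -> ev w = 1.
Proof. by move=> pw; inversion pw. Qed.

Lemma padded_split c1 x c2 w : padded (c1 ++ x :: c2) w ->
  exists w1 w2, [/\ w = w1 ++ x :: w2, padded c1 w1 & padded c2 w2].
Proof.
move Ec: (c1 ++ x :: c2) => c cw; elim: cw c1 Ec => {c w} [|e y c w e1 cw IH].
  by move=> e _ [].
case=> [|z c1] /= [-> Ec].
  rewrite Ec in cw *; exists e, w; split=> //; exact: padded_nil.
have [w1 [w2 [-> c1w1 c2w2]]] := IH _ Ec.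
exists (e ++ y :: w1), w2; split=> //; first by rewrite -catA.
exact: padded_cons.
Qed.

(** If a new letter [x] cancels the head of [reduce w], then [x], the padding after it and that head
    together represent the identity, so they join the padding before the next letter. *)
Lemma padded_reduce w : padded (reduce w) w.
Proof.
elim: w => [|x w IH]; first exact: padded_nil (word_eval_nil _).
have pxw : padded (x :: reduce w) (x :: w).
  exact: (@padded_cons [::]) (word_eval_nil _) IH.
rewrite [reduce _]/=; case: (reduce w) IH pxw => [//|y r] IH pxw /=.
case: eqP => // yx.
have [w1 [w2 [-> /padded_nilE w1e rw2]]] := @padded_split [::] _ _ _ IH.
rewrite -cat_rcons -cat_cons; apply: padded_catl => //.
rewrite word_eval_cons -cats1 word_eval_cat w1e mul1g word_eval_cons.
by rewrite word_eval_nil yx letter_eval_inv mulg1 mulgV.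
Qed.

End Words.

(** * A grammar producing conjugates from both ends *)

Section ConjugateGrammar.
Variables (A T : finType) (phi : seq (letter A) -> T).
Hypothesis phi_cat : forall u u' v v',
  phi u = phi u' -> phi v = phi v' -> phi (u ++ v) = phi (u' ++ v').
Hypothesis phi_nil : forall u, phi u = phi [::] -> u = [::].
Implicit Types (x : letter A) (u v w y : seq (letter A)).
Variable K : set (free_group A).
Local Notation ev := (word_eval (@fg_gen A)).

Definition conj_word u y1 y2 := invw u ++ y2 ++ y1 ++ u.

(* [None] generates the words representing the identity; [Some (t, b, a)] what
   may stand between a prefix [u^-1 y2] and a suffix [y1 u] already produced,
   of which only the types [t], [b], [a] of [u], [y1], [y2] are remembered. *)
Definition conj_interp (n : option (T * T * T)) : set (seq (letter A)) :=
  if n is Some (t, b, a) then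
    [set w | forall u y1 y2, phi u = t -> phi y1 = b -> phi y2 = a ->
       K (ev (invw u ++ y2 ++ w ++ y1 ++ u))]
  else [set w | ev w = 1].

Let N := option (T * T * T).
(** Five is the length of the longest production needed: [E], [x^-1], a nonterminal [J], [x],
    [E]. *)
Let S := sound_grammar conj_interp (Some (phi [::], phi [::], phi [::])) 5.
Let E : N + letter A := inl None.
Let J u y1 y2 : N + letter A := inl (Some (phi u, phi y1, phi y2)).
Let der (a : N + letter A) w := @derives _ S [:: a] [seq inr x | x <- w].

Lemma interp1 (n : N) w : interp conj_interp [:: inl n] w -> conj_interp n w.
Proof. by move=> [u [v [-> nu ->]]]; rewrite cats0. Qed.

(** The first letter [x] of a nonempty identity word must cancel, so the word is [x e1 x^-1 e2] with
    shorter identity words [e1] and [e2]. *)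
Lemma der_identity e : ev e = 1 -> der E e.
Proof.
have [m] := ubnP (size e); elim: m e => // m IH [|x e] /=.
  by move=> _ _; apply: derives_sound => //= w ->; apply: word_eval_nil.
rewrite ltnS => sz e1.
have : reduce e = [:: invl x].
  rewrite -[RHS](@reduce_id _ [:: invl x]) //; apply: ev_eq_reduce.
  rewrite word_eval_cons word_eval_nil mulg1 letter_eval_inv.
  by apply: (mulgI (letter_eval (@fg_gen A) x)); rewrite mulgV -word_eval_cons.
have := padded_reduce e => /[swap] -> /(@padded_split _ [::]).
move=> [e1' [e2' [Ee /padded_nilE e1'1 /padded_nilE e2'1]]].
rewrite Ee size_cat /= in sz *.
apply: (@rt_trans _ _ _ [:: inr x; E; inr (invl x); E]).
  apply: derives_sound => //.
  move=> _ [_ [w1 [-> -> [u [w2 [-> u1 [_ [w3 [-> ->]]]]]]]]].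
  move=> [v [_ [-> v1 ->]]] /=.
  rewrite cats0 word_eval_cons word_eval_cat u1 mul1g word_eval_cons v1 mulg1.
  by rewrite letter_eval_inv mulgV.
rewrite /= map_cat /=; apply: (@derives_cat _ S [:: inr x] _ [:: inr x]).
  exact: rt_refl.
apply: (@derives_cat _ S [:: E]).
  by apply: IH => //; apply: leq_ltn_trans sz; rewrite leq_addr.
apply: (@derives_cat _ S [:: inr (invl x)] _ [:: inr (invl x)]).
  exact: rt_refl.
by apply: IH => //; apply: leq_ltn_trans sz; rewrite addnS leqW ?leq_addl.
Qed.

Lemma der_padr a x e w : ev e = 1 -> der a w ->
  @derives _ S [:: a; inr x; E] [seq inr z | z <- w ++ x :: e].
Proof.
move=> e1 aw; rewrite map_cat /=; apply: (@derives_cat _ S [:: a]) => //.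
apply: (@derives_cat _ S [:: inr x] _ [:: inr x]); first exact: rt_refl.
exact: der_identity.
Qed.

Lemma der_padl s x e w : ev e = 1 ->
  @derives _ S s [seq inr z | z <- w] ->
  @derives _ S [:: E, inr x & s] [seq inr z | z <- e ++ x :: w].
Proof.
move=> e1 sw; rewrite map_cat /=; apply: (@derives_cat _ S [:: E]).
  exact: der_identity.
by apply: (@derives_cat _ S [:: inr x] _ [:: inr x]); first exact: rt_refl.
Qed.

(** This is exactly the soundness of the closing production from [J u y1 y2] to [E]. *)
Definition conj_stable u y1 y2 := forall u' y1' y2',
  phi u' = phi u -> phi y1' = phi y1 -> phi y2' = phi y2 ->
  K (ev (conj_word u' y1' y2')).

(** Last phase: the letters of [a] are produced from its right end and pass into the type of [y1];
    once [a] is empty, [J] closes to [E]. *)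
Lemma der_right u y1 y2 a w : conj_stable u (a ++ y1) y2 -> padded a w ->
  der (J u y1 y2) w.
Proof.
elim/last_ind: a w y1 => [|a x IH] w y1 st.
  move=> /padded_nilE w1.
  apply: (@rt_trans _ _ _ [:: E]); last exact: der_identity.
  apply: derives_sound => // z /interp1 /= z1 u' y1' y2' eu e1 e2.
  have := st _ _ _ eu e1 e2; rewrite /conj_word !word_eval_cat.
  by rewrite z1 mul1g.
rewrite -cats1 => /padded_split[w1 [w2 [-> aw1 /padded_nilE w21]]].
apply: (@rt_trans _ _ _ [:: J u (x :: y1) y2; inr x; E]); last first.
  by apply: der_padr => //; apply: IH => //; rewrite -cat_rcons.
apply: derives_sound => // _ [z [_ [-> Jz [_ [z2 [-> -> /interp1/= z21]]]]]].
move=> u' y1' y2' eu e1 e2.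
have := Jz u' (x :: y1') y2' eu (@phi_cat [:: x] [:: x] _ _ erefl e1) e2.
rewrite !word_eval_cat !word_eval_cons z21; congr K.
by rewrite !mulg1 !mulgA.
Qed.

(** Middle phase: the letters of [a] are produced from its left end and pass into the type of [y2];
    [b] is then left to [der_right]. *)
Lemma der_left u y1 y2 a b w : conj_stable u b (y2 ++ a) ->
  padded (a ++ b) w -> y1 = [::] -> der (J u y1 y2) w.
Proof.
elim: a w y2 => [|x a IH] w y2 st; rewrite ?cats0 in st.
  by move=> bw y10; apply: der_right bw; rewrite y10 cats0.
move=> /(@padded_split _ [::])[w1 [w2 [-> /padded_nilE w11 aw2]]] y10.
apply: (@rt_trans _ _ _ [:: E; inr x; J u y1 (rcons y2 x)]); last first.
  by apply: der_padl => //; apply: IH => //; rewrite cat_rcons.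
apply: derives_sound => // _ [z [_ [-> z1 [_ [z2 [-> -> /interp1 Jz]]]]]].
move=> u' y1' y2' eu e1 e2.
have := Jz u' y1' (rcons y2' x) eu e1; rewrite -!cats1 => /(_ (phi_cat e2 erefl)).
rewrite !word_eval_cat !word_eval_cons z1 word_eval_nil; congr K.
by rewrite !mulg1 !mul1g !mulgA.
Qed.

(** First phase: the last letter of [v] is produced on the right together with its inverse on the
    left, and passes to the front of [u]. *)
Lemma der_outer u v y1 y2 w : conj_stable (v ++ u) y1 y2 ->
  padded (conj_word v y1 y2) w -> der (J u [::] [::]) w.
Proof.
elim/last_ind: v u w => [|v x IH] u w st.
  by rewrite /conj_word cats0 => pw; apply: (@der_left u [::] [::] y2 y1).
rewrite /conj_word -cats1 invw_cat /= => /(@padded_split _ [::]).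
move=> [w1 [w2 [-> /padded_nilE w11]]]; rewrite !catA => /padded_split.
move=> [w3 [w4 [-> vw3 /padded_nilE w41]]].
apply: (@rt_trans _ _ _ [:: E; inr (invl x); J (x :: u) [::] [::]; inr x; E]).
  apply: derives_sound => //.
  move=> _ [z [_ [-> z1 [_ [z4 [-> ->]]]]]].
  move=> [z' [z5 [-> Jz [_ [z3 [-> -> /interp1 z2]]]]]].
  (* Both middle factors are empty here, so the new pair of letters is adjacent to [u'^-1] and
     [u']. *)
  move=> u' y1' y2' eu /phi_nil-> /phi_nil->.
  have := Jz (x :: u') [::] [::] (@phi_cat [:: x] [:: x] _ _ erefl eu) erefl erefl.
  rewrite invw_cons -cats1 !cat0s !word_eval_cat !word_eval_cons z1 z2.
  by rewrite word_eval_nil !mulg1 !mul1g !mulgA.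
apply: der_padl => //; apply: der_padr => //; apply: IH.
  by rewrite -cat_rcons.
by rewrite /conj_word !catA.
Qed.

Lemma context_free_of_conj :
  (forall g, K g -> exists u y1 y2, [/\ g = ev (conj_word u y1 y2),
     reduced (conj_word u y1 y2) & conj_stable u y1 y2]) ->
  context_free_subset (@fg_gen A) K.
Proof.
move=> Kred; exists S; apply/seteqP; split=> w.
  move=> /Kred[u [y1 [y2 [Ew red st]]]].
  apply: (@der_outer [::] u y1 y2); first by rewrite cats0.
  have := padded_reduce w; rewrite (ev_eq_reduce Ew).
  by rewrite (reduce_id red).
move=> /sound_grammar_sound/(_ [::] [::] [::] erefl erefl erefl).
by rewrite /= cats0.
Qed.

End ConjugateGrammar.

(** * Runs of automata and their transition relations *)

Section Runs.
Variables (X : finType) (M : automaton X).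
Implicit Types (p q : state M) (u v w : seq X).

Fixpoint run p w q : bool :=
  if w is x :: w' then [exists r, edge p x r && run r w' q] else p == q.

Lemma run_cat p u v q :
  run p (u ++ v) q = [exists r, run p u r && run r v q].
Proof.
elim: u p => [|x u IH] p /=.
  apply/idP/existsP => [pvq|[r /andP[/eqP-> //]]].
  by exists p; rewrite eqxx.
apply/existsP/existsP => [[r /andP[pr]]|[s /andP[/existsP[r /andP[pr rs]] sq]]].
  rewrite IH => /existsP[s /andP[rs sq]]; exists s; rewrite sq andbT.
  by apply/existsP; exists r; rewrite pr.
by exists r; rewrite pr IH; apply/existsP; exists s; rewrite rs.
Qed.

Lemma accepts_fromP p w :
  reflect (exists2 q, q \in terminal M & run p w q) (accepts_from p w).
Proof.
elim: w p => [|x w IH] p /=.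
  by apply: (iffP idP) => [pT|[q qT /eqP-> //]]; exists p.
apply: (iffP existsP) => [[r /andP[pr /IH[q qT rq]]]|].
  by exists q => //; apply/existsP; exists r; rewrite pr.
move=> [q qT /existsP[r /andP[pr rq]]]; exists r; rewrite pr.
by apply/IH; exists q.
Qed.

Definition transitions w : {set state M * state M} :=
  [set pq | run pq.1 w pq.2].

Lemma transitionsE u v : transitions u = transitions v ->
  forall p q, run p u q = run p v q.
Proof. by move=> /setP uv p q; have := uv (p, q); rewrite !inE. Qed.

Lemma transitions_cat u u' v v' :
  transitions u = transitions u' -> transitions v = transitions v' ->
  transitions (u ++ v) = transitions (u' ++ v').
Proof.
move=> /transitionsE uu' /transitionsE vv'; apply/setP => -[p q].
rewrite !inE /= !run_cat; apply: eq_existsb => r.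
by rewrite uu' vv'.
Qed.

Lemma recognized_transitions u v :
  transitions u = transitions v -> recognized M u -> recognized M v.
Proof.
move=> /transitionsE uv /existsP[p /andP[pI /accepts_fromP[q qT puq]]].
apply/existsP; exists p; rewrite pI; apply/accepts_fromP.
by exists q; rewrite -?uv.
Qed.

End Runs.

(** * Saturated automata accepting reduced forms *)

Section Saturation.
Variables (A : finType) (M : automaton (letter A)).
Implicit Types (p q : state M) (w : seq (letter A)).
Local Notation ev := (word_eval (@fg_gen A)).

Definition reach p (g : free_group A) q := exists2 w, run p w q & ev w = g.

(* Benois: a letter may be read along any path whose label represents it. *)
Definition saturation : automaton (letter A) :=
  @Automaton _ (state M) (initial M)
    [set p | `[< exists2 q, q \in terminal M & reach p 1 q >]]
    (fun p x q => `[< reach p (ev [:: x]) q >]).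

Lemma saturation_sound w :
  recognized saturation w -> (ev @` recognized M) (ev w).
Proof.
move=> /existsP[p /andP[pI]].
suff acc p' : accepts_from (M := saturation) p' w ->
    exists2 q, q \in terminal M & reach p' (ev w) q.
  move=> /acc[q qT [v pq <-]]; exists v => //.
  apply/existsP; exists p; rewrite pI; apply/accepts_fromP.
  by exists q.
elim: w p' => [|x w IH] p' /=.
  by rewrite inE => /asboolP; rewrite word_eval_nil.
move=> /existsP[r /andP[/asboolP[v1 pr v1x] /IH[q qT [v2 rq v2w]]]].
exists q => //; exists (v1 ++ v2).
  by rewrite run_cat; apply/existsP; exists r; rewrite pr.
by rewrite word_eval_cat v1x v2w -word_eval_cat.
Qed.

(** Cut an accepting run of [w] along its padding over [reduce w]: each padding word with the letter
    after it becomes one saturated edge, and the enlarged terminal set absorbs the last padding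
    word. *)
Lemma saturation_complete w :
  recognized M w -> recognized saturation (reduce w).
Proof.
move=> /existsP[p /andP[pI /accepts_fromP[q qT pq]]].
apply/existsP; exists p; rewrite pI /=.
move: (reduce w) (padded_reduce w) => c cw.
elim: cw p {pI} pq => {c w} [e e1|e x c v e1 _ IH] p.
  by move=> pq; rewrite /= inE; apply/asboolP; exists q => //; exists e.
rewrite -cat_rcons run_cat => /existsP[r /andP[pr /IH rq]] /=.
apply/existsP; exists (r : state saturation); rewrite rq andbT.
apply/asboolP; exists (rcons e x) => //.
by rewrite -cats1 word_eval_cat e1 mul1g.
Qed.

End Saturation.

Lemma rational_saturation (A : finType) (K : set (free_group A)) :
  rational_subset (@fg_gen A) K -> exists M : automaton (letter A),
    (forall w, recognized M w -> K (word_eval (@fg_gen A) w)) /\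
    (forall g, K g -> recognized M (fg_word g)).
Proof.
move=> [_ [M ->] ->]; exists (saturation M); split=> [w|_ [w wM <-]].
  exact: saturation_sound.
by rewrite word_eval_fg_gen; apply: saturation_complete.
Qed.

(** * Cancellation in a conjugate of a reduced word *)

Section Decomposition.
Variable A : finType.
Implicit Types (x z : letter A) (u v w k y : seq (letter A)).

Definition iterw n w := flatten (nseq n w).

Local Notation noncancel := (fun x z : letter A => z != invl x).

Lemma iterw_rot n x w : iterw n (x :: w) ++ [:: x] = x :: iterw n (rcons w x).
Proof.
elim: n => //= n IH.
by rewrite /iterw /= -/(iterw _ _) -catA -cat_cons IH cat_rcons.
Qed.

Lemma iterwSr n w : iterw n.+1 w = iterw n w ++ w.
Proof.
elim: n => [|n IH]; first by rewrite /iterw /= cats0.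
by rewrite -[LHS]/(w ++ iterw n.+1 w) {1}IH catA.
Qed.

(** The two inequalities exclude cancellation at the junctions of [u^-1] with [x k] and of [x k]
    with [u]. *)
Lemma reduced_conj x k u : reduced (x :: k) -> reduced u ->
  (if u is z :: _ then (z != x) && (z != invl (last x k)) else true) ->
  reduced (conj_word u [::] (x :: k)).
Proof.
case: u => [|z u] xk zu; rewrite /conj_word ?cats0 //= => /andP[zx zk].
rewrite invw_cons cat_rcons /reduced sorted_cat_cons -invw_cons.
apply/andP; split; first exact: reduced_inv zu.
rewrite /= invlK eq_sym zx cat_path /= zk.
by rewrite [path _ _ k]xk.
Qed.

(** Induction on [u]: a first letter equal to that of [k] cancels and turns [k] into its rotation.
    As [u] is reduced, its next letter cannot cancel the new last letter of [k], so the hypothesis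
    persists. *)
Lemma cyclic_conj k u : k != [::] -> cycle noncancel k -> reduced u ->
  (if u is z :: _ then z != invl (last z k) else true) ->
  exists n y1 y2 u2, [/\ k = y1 ++ y2, u = iterw n k ++ y1 ++ u2 &
    reduced (conj_word u2 y1 y2)].
Proof.
elim: u k => [|z u IH] [//|x k] _ kcyc uR uk.
  exists 0, [::], (x :: k), [::]; split=> //.
  by apply: reduced_conj => //; move: kcyc => /=; rewrite rcons_path => /andP[].
have kR : reduced (x :: k) by move: kcyc => /=; rewrite rcons_path => /andP[].
have [zx|zx] := eqVneq z x; last first.
  exists 0, [::], (x :: k), (z :: u); split=> //.
  by apply: reduced_conj => //=; rewrite zx.
rewrite {z}zx in uR uk *.
have [||||n [y1 [y2 [u2 [Ek Eu R]]]]] := IH (rcons k x).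
- by case: k {kcyc kR uk}.
- by rewrite -rot1_cons rot_cycle.
- exact: path_sorted uR.
- by case: u uR {IH uk} => //= z u /andP[+ _]; rewrite last_rcons.
(* If [y2] is empty, undoing the rotation completes a period and [n] increases; otherwise the last
   letter of [y2] is [x], which moves to the front of [y1]. *)
rewrite Eu; case/lastP: y2 Ek R => [|y2 z] Ek R.
  rewrite cats0 in Ek; exists n.+1, [:: x], k, u2; split=> //.
    by rewrite [RHS]catA iterw_rot iterwSr -Ek /= -catA.
  by move: R; rewrite /conj_word -Ek -cats1 -!catA.
move: Ek; rewrite -rcons_cat => /rcons_inj[Ek zx]; rewrite -{z}zx in R.
exists n, (x :: y1), y2, u2; split.
- by rewrite Ek.
- by rewrite -cat_cons -iterw_rot -catA.
- by move: R; rewrite /conj_word cat_rcons.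
Qed.

Lemma cycle_invw k : cycle noncancel (invw k) = cycle noncancel k.
Proof.
rewrite /invw rev_cycle cycle_map.
by apply: eq_cycle => x z /=; rewrite invlK eq_sym -eq_invl eq_sym.
Qed.

(** Induction on the length of [k]: outer pairs [x], [x^-1] of [k] go into [c] as long as [u] starts
    with [x]; a cyclically reduced [k] is handled by [cyclic_conj]. *)
Lemma conj_decomposition k u : k != [::] -> reduced k -> reduced u ->
  exists n c y1 y2 u2, [/\ k = c ++ y1 ++ y2 ++ invw c,
    u = c ++ iterw n (y1 ++ y2) ++ y1 ++ u2 \/
    u = c ++ iterw n (invw (y1 ++ y2)) ++ invw y2 ++ u2 &
    reduced (conj_word u2 y1 y2)].
Proof.
have [m] := ubnP (size k); elim: m k u => // m IH [//|x k] u km _ kR uR.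
have [xk|xk] := eqVneq x (invl (last x k)); last first.
  have kcyc : cycle noncancel (x :: k) by rewrite /= rcons_path xk andbT.
  have [uk|uk] := boolP (if u is z :: _ then z != invl (last z (x :: k)) else true).
    have [n [y1 [y2 [u2 [Ek Eu R]]]]] := @cyclic_conj (x :: k) u isT kcyc uR uk.
    exists n, [::], y1, y2, u2; split=> //; last by left; rewrite -Ek.
    by rewrite cats0.
  (* Now [u] starts with the first letter of [k^-1], so cancellation follows powers of [k^-1];
     inverting the resulting conjugate swaps the roles of [y1] and [y2]. *)
  have [||||n [y1 [y2 [u2 [Ek Eu R]]]]] := @cyclic_conj (invw (x :: k)) u.
  - by rewrite invw_cons; case: (invw k).
  - by rewrite cycle_invw.
  - by [].
  - case: u uk {uR} => //= z u; rewrite invw_cons last_rcons invlK negbK.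
    by move=> /eqP->; rewrite eq_sym.
  exists n, [::], (invw y2), (invw y1), u2; split.
  - by rewrite cats0 -invw_cat -Ek invwK.
  - by right; rewrite -invw_cat !invwK -Ek.
  - by have := reduced_inv R; rewrite -/(invw _) /conj_word !invw_cat invwK -!catA.
case/lastP: k => [|k z] in km kR xk *.
  by move: (invl_neq x); rewrite -xk eqxx.
rewrite last_rcons in xk; have Ez : z = invl x by rewrite xk invlK.
rewrite {z xk}Ez in km kR *.
have k0 : k != [::] by case: k kR {km} => //=; rewrite /reduced /= eqxx.
have [ux|ux] := boolP (if u is z :: _ then z == x else false).
  case: u uR ux => // z u uR /eqP zx; rewrite {z}zx in uR *.
  have [|||n [c [y1 [y2 [u2 [Ek Eu R]]]]]] := IH k u _ k0.
  - by move: km; rewrite /= size_rcons => /ltnW.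
  - by move: kR; rewrite /reduced /= rcons_path => /andP[/path_sorted].
  - exact: path_sorted uR.
  exists n, (x :: c), y1, y2, u2; split=> //.
    by rewrite Ek invw_cons -!cats1 -!catA.
  by case: Eu => ->; [left|right].
(* Since [u] does not start with [x], nothing cancels on either side. *)
exists 0, [::], [::], (x :: rcons k (invl x)), u; split=> //.
- by rewrite cats0.
- by left.
apply: reduced_conj => //; case: u ux {uR} => //= z u.
by rewrite last_rcons invlK andbb.
Qed.

End Decomposition.

(** * Evaluation of powers and conjugates *)

Lemma word_eval_iterw (A : finType) (G : groupType) (g : A -> G) n w :
  word_eval g (iterw n w) = word_eval g w ^+ n.
Proof.
elim: n => [|n IH]; first by rewrite word_eval_nil.
by rewrite expgS -IH -word_eval_cat.
Qed.

(** The powers of [y1 y2] and of its inverse commute with [y1 y2], so they drop out of the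
    conjugate. *)
Lemma word_eval_conj_word (A : finType) (G : groupType) (g : A -> G)
    n (c y1 y2 u v : seq (letter A)) :
  v = c ++ iterw n (y1 ++ y2) ++ y1 ++ u \/
  v = c ++ iterw n (invw (y1 ++ y2)) ++ invw y2 ++ u ->
  word_eval g (conj_word u y1 y2) =
  (word_eval g v)^-1 * word_eval g (c ++ y1 ++ y2 ++ invw c) * word_eval g v.
Proof.
move=> Ev; apply: (mulgI (word_eval g v)); rewrite -mulgA mulVKg; apply/esym.
case: Ev => ->.
  have := commuteX n (commute_refl (word_eval g (y1 ++ y2))).
  rewrite -(word_eval_iterw g) /conj_word !(word_eval_cat, word_eval_inv).
  move: (word_eval g c) (word_eval g y1) (word_eval g y2) (word_eval g u)
    (word_eval g (iterw _ _)) => C Y1 Y2 U N com.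
  rewrite !mulgA mulgVK mulgK -(mulgA C Y1) -(mulgA C (Y1 * Y2)) com.
  by rewrite !mulgA.
have := commuteX n (commuteV (commute_refl (word_eval g (y1 ++ y2)))).
rewrite -(word_eval_inv g) -(word_eval_iterw g) /conj_word.
rewrite !(word_eval_cat, word_eval_inv).
move: (word_eval g c) (word_eval g y1) (word_eval g y2) (word_eval g u)
  (word_eval g (iterw _ _)) => C Y1 Y2 U N com.
rewrite !mulgA !mulgVK mulgK -(mulgA C Y1) -(mulgA C (Y1 * Y2)) com.
by rewrite !mulgA mulgK mulgVK.
Qed.

(** * Word types, and context-freeness of the set of conjugates *)

Section WordType.
Variables (A : finType) (M : automaton (letter A)).
Implicit Types (u v w : seq (letter A)).

(** Inverses are recorded because the conjugator may contain [y2^-1] and powers of [(y1 y2)^-1]. *)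
Definition word_type w := (transitions M w, transitions M (invw w)).

Lemma word_type_cat u u' v v' : word_type u = word_type u' ->
  word_type v = word_type v' -> word_type (u ++ v) = word_type (u' ++ v').
Proof.
move=> [uu' iuu'] [vv' ivv']; rewrite /word_type !invw_cat.
by rewrite (transitions_cat uu' vv') (transitions_cat ivv' iuu').
Qed.

Lemma word_type_inv u u' :
  word_type u = word_type u' -> word_type (invw u) = word_type (invw u').
Proof. by move=> [uu' iuu']; rewrite /word_type !invwK uu' iuu'. Qed.

Lemma word_type_iterw n u u' :
  word_type u = word_type u' -> word_type (iterw n u) = word_type (iterw n u').
Proof. by move=> uu'; elim: n => //= n IH; apply: word_type_cat. Qed.

Lemma recognized_word_type u v :
  word_type u = word_type v -> recognized M u -> recognized M v.
Proof. by move=> [uv _]; apply: recognized_transitions. Qed.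

End WordType.

Theorem theorem3p5 (A : finType) (K L : set (free_group A)) :
  rational_subset (@fg_gen A) K -> rational_subset (@fg_gen A) L ->
  context_free_subset (@fg_gen A) (alpha K L).
Proof.
move=> /rational_saturation[MK [MK_K K_MK]] /rational_saturation[ML [ML_L L_ML]].
(* The component [nilp w] makes the type single out the empty word, as transition relations alone
   need not. *)
pose phi w := (nilp w, word_type MK w, word_type ML w).
have phiP u v : phi u = phi v -> [/\ nilp u = nilp v,
    word_type MK u = word_type MK v & word_type ML u = word_type ML v].
  by rewrite /phi /word_type => -[-> -> -> -> ->].
have phi_nil w : phi w = phi [::] -> w = [::] by case/phiP=> /nilP.
apply: (@context_free_of_conj _ _ phi) => //.
  move=> u u' v v' /phiP[nu Ku Lu] /phiP[nv Kv Lv].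
  rewrite /phi (word_type_cat Ku Kv) (word_type_cat Lu Lv).
  by case: u u' v v' nu nv {Ku Kv Lu Lv} => [|? ?] [|? ?] [|? ?] [|? ?].
move=> _ [h Lh [k Kk <-]].
(* For trivial [k] the conjugate is 1; three empty factors represent it and are determined by their
   types. *)
have [k1|k1] := eqVneq (fg_word k) [::].
  have g1 : word_eval (@fg_gen A) [::] = h^-1 * k * h.
    by rewrite -(word_eval_fg_word k) k1 word_eval_nil mulg1 mulVg.
  exists [::], [::], [::]; split=> // u y1 y2 /phi_nil-> /phi_nil-> /phi_nil->.
  by rewrite /conj_word /= g1; exists h => //; exists k.
have [n [c [y1 [y2 [u [Ek Eh R]]]]]] :=
  conj_decomposition k1 (fg_wordP k) (fg_wordP h).
exists u, y1, y2; split=> //.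
  by rewrite (word_eval_conj_word _ Eh) -Ek !word_eval_fg_word.
move=> u' y1' y2' /phiP[_ uK uL] /phiP[_ y1K y1L] /phiP[_ y2K y2L].
have K' : K (word_eval (@fg_gen A) (c ++ y1' ++ y2' ++ invw c)).
  apply/MK_K/(recognized_word_type _ (K_MK _ Kk)); rewrite Ek.
  by do ![apply: word_type_cat => //].
have y12L : word_type ML (y1 ++ y2) = word_type ML (y1' ++ y2').
  exact: word_type_cat.
(* Keeping [c], [n] and the sign of the power, replace the factors of [h] by words of the same
   types; the new conjugator [v] then has the type of [h]. *)
have [v Ev Lv] : exists2 v, v = c ++ iterw n (y1' ++ y2') ++ y1' ++ u' \/
    v = c ++ iterw n (invw (y1' ++ y2')) ++ invw y2' ++ u' &
    word_type ML (fg_word h) = word_type ML v.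
  case: Eh => ->; eexists; [by left| |by right|].
    by do ![apply: word_type_cat => //]; apply: word_type_iterw.
  do ![apply: word_type_cat => //]; last exact: word_type_inv.
  by apply/word_type_iterw/word_type_inv.
exists (word_eval (@fg_gen A) v).
  exact/ML_L/(recognized_word_type Lv)/L_ML.
by rewrite (word_eval_conj_word _ Ev); exists (word_eval (@fg_gen A)
  (c ++ y1' ++ y2' ++ invw c)).
Qed.
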